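(* There exist universal constants $c,c_1,c_2>0$ and thresholds $\varepsilon_0,\delta_0>0$, $S_0,A_0\in\mathbb N$ such that the following holds. For any $0<\varepsilon\le\varepsilon_0$, any $0<\delta\le\delta_0$, any integers $S\ge S_0$, $A\ge A_0$, any $D\ge\max\{c_1\log_A S,\,c_2\}$, and any algorithm $\mathscr A$ with generative-model access that is $(\varepsilon,\delta)$-correct for communicating average-reward MDPs, there is a communicating MDP with at most $S$ states, at most $A$ actions and diameter at most $D$ such that, when $\mathscr A$ is run on this MDP, the expected total number of samples it draws over all state-action pairs is at least \[ c\,S\,A\,D\,\varepsilon^{-2}\ln\frac1\delta. \]
   Context: An MDP is a tuple $M=(\mathcal S,\mathcal A,P,r)$ with finite state set $\mathcal S$, finite action set $\mathcal A$, transition probabilities $P(s'\mid s,a)$ and known deterministic reward $r:\mathcal S\times\mathcal A\to[0,1]$. A stationary policy $\pi$ assigns to each state a probability distribution on $\mathcal A$. Its gain is $\rho^\pi(s):=\lim_{T\to\infty}\frac1T\mathbb E^\pi[\sum_{t=0}^{T-1}r(s_t,a_t)\mid s_0=s]$, and $\rho^*:=\max_\pi\rho^\pi$. A stationary policy $\pi$ is $\varepsilon$-optimal (for the average-reward problem) if $\rho^\pi\ge\rho^*-\varepsilon$ at every state. The diameter of $M$ is $\max_{s_1\ne s_2}\min_\pi\mathbb E^\pi_{s_1}[\tau_{s_2}]$, where $\tau_{s_2}$ is the hitting time of $s_2$; $M$ is communicating if its diameter is finite. A generative model of $M$ returns, on each query $(s,a)$, an independent sample $s'\sim P(\cdot\mid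 s,a)$. An algorithm knows $\mathcal S,\mathcal A,r$ but not $P$, may query the generative model adaptively and may be randomized, and outputs a stationary policy. It is $(\varepsilon,\delta)$-correct if for every communicating MDP it outputs an $\varepsilon$-optimal stationary policy with probability at least $1-\delta$. *)

(* Defs.v *)
(* MathComp world, with MathComp-Analysis over an abstract R : realType. *)
From HB Require Import structures.
From mathcomp Require Import all_boot all_order all_algebra.
From mathcomp Require Import all_classical all_reals all_analysis.

Set Implicit Arguments.
Unset Strict Implicit.
Unset Printing Implicit Defensive.

Import Order.TTheory GRing.Theory Num.Theory.
Import numFieldNormedType.Exports.

Local Open Scope classical_set_scope.
Local Open Scope ring_scope.

Record fdist (R : realType) (T : finType) := FDist {
  pmf :> {ffun T -> R};
  _ : [forall t, 0 <= pmf t] && (\sum_t pmf t == 1) }.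

HB.instance Definition _ (R : realType) (T : finType) :=
  [isSub for @pmf R T].
HB.instance Definition _ (R : realType) (T : finType) :=
  [Choice of fdist R T by <:].

Lemma dirac_pmf_subproof (R : realType) (T : finType) (t0 : T) :
  let f := [ffun t => (t == t0)%:R] : {ffun T -> R} in
  [forall t, 0 <= f t] && (\sum_t f t == 1).
Proof.
apply/andP; split; first by apply/forallP => t; rewrite ffunE ler0n.
rewrite (bigD1 t0) //= ffunE eqxx big1 ?addr0 // => t tN.
by rewrite ffunE (negbTE tN).
Qed.

Definition fdist_dirac (R : realType) (T : finType) (t0 : T) : fdist R T :=
  FDist (dirac_pmf_subproof R t0).

(* An MDP without its transition law: the part known to a learner. *)
Record environment (R : realType) := Environment {
  state : finType;
  action : finType;
  reward : state -> action -> R;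
  _ : (0 < #|state|)%N;
  action_gt0 : (0 < #|action|)%N;
  _ : forall s a, 0 <= reward s a <= 1 }.

Record mdp (R : realType) := MDP {
  env :> environment R;
  trans : state env -> action env -> fdist R (state env) }.

Definition policy (R : realType) (E : environment R) :=
  {ffun state E -> fdist R (action E)}.

Definition point_policy (R : realType) (E : environment R) : policy E :=
  [ffun=> fdist_dirac R (enum_val (Ordinal (action_gt0 E)))].

HB.instance Definition _ (R : realType) (E : environment R) :=
  Choice.on (policy E).
HB.instance Definition _ (R : realType) (E : environment R) :=
  isPointed.Build (policy E) (@point_policy R E).

(* The space of policies carries the Borel sigma-algebra of
   R^(state * action), i.e. the one generated by the coordinates pi s a. *)
Definition policy_cylinders (R : realType) (E : environment R) :
    set (set (policy E)) :=
  [set B | exists (s : state E) (a : action E) (U : set R),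
     measurable U /\ B = [set pi : policy E | U (pi s a)]].

Definition policy_space (R : realType) (E : environment R) :=
  g_sigma_algebraType (@policy_cylinders R E).

Section Trajectories.
Variables (R : realType) (M : mdp R) (pi : policy M).

(* A trajectory s_0, a_0, s_1, ..., a_(n-1), s_n is given by its initial state
   s_0 and the list [:: (a_0, s_1); ...; (a_(n-1), s_n)]. *)
Fixpoint traj_prob (s : state M) (tr : seq (action M * state M)) : R :=
  if tr is (a, s') :: tr' then pi s a * trans s a s' * traj_prob s' tr'
  else 1.

Fixpoint traj_reward (s : state M) (tr : seq (action M * state M)) : R :=
  if tr is (a, s') :: tr' then reward s a + traj_reward s' tr' else 0.

Definition expected_return (n : nat) (s : state M) : R :=
  \sum_(tr : n.-tuple (action M * state M)) traj_prob s tr * traj_reward s tr.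

Definition gain (s : state M) : R :=
  limn (fun n => n%:R^-1 * expected_return n s).

Definition unhit_prob (s1 s2 : state M) (n : nat) : R :=
  \sum_(tr : n.-tuple (action M * state M) | s2 \notin s1 :: unzip2 tr)
    traj_prob s1 tr.

(* The hitting time is tau = \sum_n 1[s_0, ..., s_n all differ from s2], with
   value +oo if s2 is never reached; hence E[tau] = \sum_n P(tau > n). *)
Definition expected_hitting_time (s1 s2 : state M) : \bar R :=
  (\sum_(n <oo) (unhit_prob s1 s2 n)%:E)%E.

End Trajectories.

Definition optimal_gain (R : realType) (M : mdp R) (s : state M) : R :=
  sup [set gain pi s | pi in [set: policy M]].

Definition eps_optimal (R : realType) (M : mdp R) (eps : R) (pi : policy M) :=
  forall s : state M, optimal_gain s - eps <= gain pi s.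

Definition diameter (R : realType) (M : mdp R) : \bar R :=
  \big[maxe/0%E]_(p : state M * state M | p.1 != p.2)
    ereal_inf [set expected_hitting_time pi p.1 p.2 | pi in [set: policy M]].

Definition communicating (R : realType) (M : mdp R) := (diameter M < +oo)%E.

(* The list of (queried state, queried action, sampled next state), the most
   recent sample first. *)
Definition history (R : realType) (E : environment R) :=
  seq (state E * action E * state E).

(* A randomized adaptive sampling rule in behavioural form. After history h,
   [next_query h] is the law of the next query, where None means stop; upon
   stopping, [output h] is the law of the returned policy. *)
Record strategy (R : realType) (E : environment R) := Strategy {
  next_query : history E -> fdist R (option (state E * action E));
  output : history E -> probability (policy_space E) R }.

Definition algorithm (R : realType) := forall E : environment R, strategy E.

Section Run.
Variables (R : realType) (alg : algorithm R) (M : mdp R).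

(* The probability that the first [size h] samples are drawn and form h. *)
Fixpoint history_prob (h : history M) : R :=
  if h is (s, a, s') :: h' then
    history_prob h' * next_query (alg M) h' (Some (s, a)) * trans s a s'
  else 1.

Definition output_prob (B : set (policy M)) : \bar R :=
  (\sum_(n <oo) \sum_(h : n.-tuple (state M * action M * state M))
     (history_prob h * next_query (alg M) h None)%:E * output (alg M) h B)%E.

(* \sum_n P(the n-th query is made, and is (s, a)). *)
Definition expected_queries (s : state M) (a : action M) : \bar R :=
  (\sum_(n <oo) (\sum_(h : n.-tuple (state M * action M * state M))
     history_prob h * next_query (alg M) h (Some (s, a)))%:E)%E.

Definition expected_samples : \bar R :=
  (\sum_(s : state M) \sum_(a : action M) expected_queries s a)%E.

End Run.

(* The event measured here is Borel, the gain being a pointwise limit of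
   polynomials in the coordinates of pi. *)
Definition correct (R : realType) (eps delta : R) (alg : algorithm R) :=
  forall M : mdp R, communicating M ->
    ((1 - delta)%:E <= output_prob alg [set pi : policy M | eps_optimal eps pi])%E.

(* Main.v *)
(** The hard instances are built on a reward-free resting state and the nodes of
    a b-ary tree, b about A/2. Each node carries b arms: an arm yields reward 1
    and is left, back to the resting state, with probability p of order 1/D,
    which is also the probability of leaving the resting state for the root;
    moving down the tree yields reward 1/2. Then every policy has gain 1/2 in the
    reference instance. Lowering the exit probability of one arm i to kappa p,
    1 - kappa = 20 eps, gives an instance M_i whose optimal gain is at least
    1/2 + 2 eps, and the excess gain of a policy in M_i is (1 - kappa)/2 times
    its frequency of arm i. Since M_i is the reference chain with some null steps
    inserted at arm i, that frequency is at most 1/kappa times the frequency of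
    arm i in the reference chain. Frequencies sum to 1, so a policy can be
    eps-optimal in at most 80 of the M_i. Run on the reference instance, the
    algorithm therefore outputs, for most i, a policy which is not eps-optimal in
    M_i, an event of probability at most delta under M_i; a change of measure with
    divergence O(eps^2/D) per query shows that arm i is queried
    Omega(D eps^-2 ln(1/delta)) times, and summing over the arms gives the bound. *)
Require Import Defs.
From HB Require Import structures.
From mathcomp Require Import all_boot all_order all_algebra.
From mathcomp Require Import all_classical all_reals all_analysis.
From mathcomp Require Import measurable_realfun.
From mathcomp Require Import zify ring lra.

Set Implicit Arguments.
Unset Strict Implicit.
Unset Printing Implicit Defensive.

Import Order.TTheory GRing.Theory Num.Theory.
Import numFieldNormedType.Exports.

Local Open Scope classical_set_scope.
Local Open Scope ring_scope.

(** * Finite expectations and values of policies *)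

Section FiniteExpectation.
Context {R : realType} {T : finType}.
Implicit Types (P : fdist R T) (f g : T -> R).

Definition mean P f := \sum_t P t * f t.

Lemma fdist_ge0 P t : 0 <= P t.
Proof. by case: P => f /= /andP[/forallP]. Qed.

Lemma fdist_sum1 P : \sum_t P t = 1.
Proof. by case: P => f /= /andP[_ /eqP]. Qed.

Lemma mean_cst P (c : R) : mean P (fun=> c) = c.
Proof. by rewrite /mean -mulr_suml fdist_sum1 mul1r. Qed.

Lemma eq_mean P f g : f =1 g -> mean P f = mean P g.
Proof. by move=> fg; apply: eq_bigr => t _; rewrite fg. Qed.

Lemma meanD P f g : mean P (fun t => f t + g t) = mean P f + mean P g.
Proof. by rewrite /mean -big_split; apply: eq_bigr => t _; rewrite mulrDr. Qed.

Lemma meanZ P (k : R) f : mean P (fun t => k * f t) = k * mean P f.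
Proof. by rewrite /mean mulr_sumr; apply: eq_bigr => t _; rewrite mulrCA. Qed.

Lemma mean_le P f g : (forall t, f t <= g t) -> mean P f <= mean P g.
Proof. by move=> fg; apply: ler_sum => t _; rewrite ler_wpM2l ?fdist_ge0. Qed.

Lemma mean_le_cst P f (k : R) : (forall t, f t <= k) -> mean P f <= k.
Proof. by move=> ?; rewrite -(mean_cst P k); apply: mean_le. Qed.

Lemma mean_dirac t f : mean (fdist_dirac R t) f = f t.
Proof.
rewrite /mean (bigD1 t) //= ffunE eqxx mul1r big1 ?addr0 // => u /negbTE ut.
by rewrite ffunE ut mul0r.
Qed.

Lemma mean_sum P (I : finType) (F : I -> T -> R) :
  mean P (fun t => \sum_i F i t) = \sum_i mean P (F i).
Proof.
rewrite /mean exchange_big /=; apply: eq_bigr => t _.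
by rewrite mulr_sumr.
Qed.

End FiniteExpectation.

Lemma sum_tuple_cons (R : nmodType) (T : finType) n (F : n.+1.-tuple T -> R) :
  \sum_t F t = \sum_x \sum_(u : n.-tuple T) F [tuple of x :: u].
Proof.
rewrite pair_big /= (reindex (fun p : T * n.-tuple T => [tuple of p.1 :: p.2])).
  by [].
exists (fun t : n.+1.-tuple T => (thead t, [tuple of behead t])).
  by case=> x u _ /=; congr pair; apply: val_inj.
by move=> t _ /=; rewrite [t in RHS]tuple_eta.
Qed.

Lemma sum_tuple0 (R : nmodType) (T : finType) (F : 0.-tuple T -> R) :
  \sum_t F t = F [tuple].
Proof.
rewrite (eq_bigr (fun=> F [tuple])) => [|t _]; last by rewrite (tuple0 t).
by rewrite big_const card_tuple expn0 /= addr0.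
Qed.

Section Values.
Context {R : realType} {M : mdp R}.
Variable pi : policy M.
Implicit Types (c : state M -> action M -> R) (f h w : state M -> R).

Definition step f (s : state M) := mean (pi s) (fun a => mean (trans s a) f).

Definition avg_cost c (s : state M) := mean (pi s) (c s).

(** Expected cost over [n] steps by recursion on the horizon, so that inductions never handle
    trajectories; [expected_returnE] links it to the sum over trajectories. *)
Fixpoint value c n (s : state M) :=
  if n is k.+1 then avg_cost c s + step (value c k) s else 0.

Lemma step_le f h s : (forall t, f t <= h t) -> step f s <= step h s.
Proof. by move=> fh; apply: mean_le => a; apply: mean_le. Qed.

Lemma eq_step f h s : f =1 h -> step f s = step h s.
Proof. by move=> fh; apply: eq_mean => a; apply: eq_mean. Qed.

Lemma step_cst (k : R) s : step (fun=> k) s = k.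
Proof. by rewrite /step (eq_mean _ (fun a => mean_cst _ k)) mean_cst. Qed.

Lemma stepD f h s : step (fun t => f t + h t) s = step f s + step h s.
Proof. by rewrite -meanD; apply: eq_mean => a; rewrite meanD. Qed.

Lemma stepZ (k : R) f s : step (fun t => k * f t) s = k * step f s.
Proof. by rewrite -meanZ; apply: eq_mean => a; rewrite meanZ. Qed.

Lemma step_sum (I : finType) (F : I -> state M -> R) s :
  step (fun t => \sum_i F i t) s = \sum_i step (F i) s.
Proof. by rewrite -mean_sum; apply: eq_mean => a; rewrite mean_sum. Qed.

Lemma valueD c c' n s :
  value (fun t a => c t a + c' t a) n s = value c n s + value c' n s.
Proof.
elim: n s => [|n IH] s /=; first by rewrite addr0.
by rewrite (eq_step _ IH) stepD /avg_cost meanD addrACA.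
Qed.

Lemma valueZ (k : R) c n s :
  value (fun t a => k * c t a) n s = k * value c n s.
Proof.
elim: n s => [|n IH] s /=; first by rewrite mulr0.
by rewrite (eq_step _ IH) stepZ /avg_cost meanZ mulrDr.
Qed.

Lemma value_cst (k : R) n s : value (fun _ _ => k) n s = n%:R * k.
Proof.
elim: n s => [|n IH] s /=; first by rewrite mul0r.
by rewrite (eq_step _ IH) step_cst /avg_cost mean_cst -natr1 mulrDl mul1r addrC.
Qed.

Lemma value_sum (I : finType) (c : I -> state M -> action M -> R) n s :
  value (fun t a => \sum_i c i t a) n s = \sum_i value (c i) n s.
Proof.
elim: n s => [|n IH] s /=; first by rewrite big1.
by rewrite (eq_step _ IH) step_sum /avg_cost mean_sum big_split.
Qed.

Lemma value_le c c' n s :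
  (forall t a, c t a <= c' t a) -> value c n s <= value c' n s.
Proof.
move=> cc; elim: n s => [//|n IH] s /=.
by apply: lerD; [apply: mean_le | apply: step_le].
Qed.

Lemma value_ge0 c n s : (forall t a, 0 <= c t a) -> 0 <= value c n s.
Proof.
move=> c0; have := value_le n s c0.
by rewrite (value_cst 0) mulr0.
Qed.

Lemma value_mono c n s :
  (forall t a, 0 <= c t a) -> value c n s <= value c n.+1 s.
Proof.
move=> c0; elim: n s => [|n IH] s; first exact: value_ge0.
by rewrite [value c n.+1 s]/= [value c n.+2 s]/= lerD2l; apply: step_le.
Qed.

(* [h] solves the Poisson equation of [c]: the discarded term of the telescoping
   sum is an average of [h]. *)
Lemma value_poisson c h (B : R) n s :
  (forall t, `|h t| <= B) ->
  (forall t, avg_cost c t + step h t = h t) ->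
  `|value c n s - h s| <= B.
Proof.
move=> hB hP; elim: n s => [|n IH] s /=; first by rewrite sub0r normrN.
have -> : avg_cost c s + step (value c n) s - h s
  = step (fun t => value c n t - h t) s.
  under [in RHS]eq_step do rewrite -mulN1r.
  by rewrite stepD stepZ -[h s in LHS]hP mulN1r; ring.
rewrite ler_norml; apply/andP; split.
  rewrite -(step_cst (- B) s); apply: step_le => t.
  by move: (IH t); rewrite ler_norml => /andP[].
rewrite -(step_cst B s); apply: step_le => t.
by move: (IH t); rewrite ler_norml => /andP[].
Qed.

(** Conditioning on the first transition: the integrand may depend on it only through the state
    reached, which is what turns the inner sum into a function of that state. *)
Lemma traj_step n (F : action M * state M -> n.-tuple (action M * state M) -> R)
    (G : state M -> n.-tuple (action M * state M) -> R) s :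
  (forall a s' tr, F (a, s') tr = G s' tr) ->
  \sum_x \sum_(tr : n.-tuple (action M * state M))
    pi s x.1 * trans s x.1 x.2 * traj_prob pi x.2 tr * F x tr
  = step (fun s' => \sum_(tr : n.-tuple _) traj_prob pi s' tr * G s' tr) s.
Proof.
move=> FG; rewrite /step /mean.
rewrite [RHS](_ : _ = \sum_a \sum_s' pi s a * (trans s a s' *
    \sum_(tr : n.-tuple (action M * state M)) traj_prob pi s' tr * G s' tr));
  last by apply: eq_bigr => a _; rewrite mulr_sumr.
rewrite [RHS]pair_big /=; apply: eq_bigr => -[a s'] _ /=.
rewrite mulr_sumr mulr_sumr; apply: eq_bigr => tr _.
by rewrite FG; ring.
Qed.

Lemma traj_prob_sum1 n s : \sum_(tr : n.-tuple _) traj_prob pi s tr = 1.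
Proof.
elim: n s => [|n IH] s; first by rewrite sum_tuple0.
rewrite sum_tuple_cons.
have := @traj_step n (fun _ _ => 1) (fun _ _ => 1) s (fun _ _ _ => erefl).
rewrite (eq_step (h := fun=> 1)) => [|t]; last first.
  by under eq_bigr do rewrite mulr1; exact: IH.
rewrite step_cst => <-.
by apply: eq_bigr => -[a s'] _; apply: eq_bigr => tr _; rewrite mulr1.
Qed.

Lemma expected_returnE n s : expected_return pi n s = value (@reward R M) n s.
Proof.
elim: n s => [|n IH] s; first by rewrite /expected_return sum_tuple0 /= mulr0.
rewrite /expected_return sum_tuple_cons /=.
have -> : step (value (@reward R M) n) s = step (expected_return pi n) s.
  by apply: eq_step => t; rewrite IH.
rewrite -(@traj_step n (fun x tr => traj_reward x.2 tr) _ s) //.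
have -> : avg_cost (@reward R M) s
  = \sum_x \sum_(tr : n.-tuple (action M * state M))
    pi s x.1 * trans s x.1 x.2 * traj_prob pi x.2 tr * reward s x.1.
  under eq_bigr => x _ do rewrite -mulr_suml -mulr_sumr traj_prob_sum1 mulr1.
  rewrite -(pair_bigA _ (fun a s' => pi s a * trans s a s' * reward s a)) /=.
  apply: eq_bigr => a _; rewrite -mulr_suml -mulr_sumr fdist_sum1.
  by rewrite mulr1.
rewrite -big_split; apply: eq_bigr => -[a s'] _ /=.
by rewrite -big_split; apply: eq_bigr => tr _ /=; rewrite mulrDr.
Qed.

Lemma unhit_prob0 s1 s2 : unhit_prob pi s1 s2 0 = (s1 != s2)%:R.
Proof.
rewrite /unhit_prob big_mkcond sum_tuple0 /= inE eq_sym.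
by case: eqP.
Qed.

Lemma unhit_probS s1 s2 n :
  unhit_prob pi s1 s2 n.+1
  = (s1 != s2)%:R * step (fun s => unhit_prob pi s s2 n) s1.
Proof.
rewrite /unhit_prob big_mkcond sum_tuple_cons /=.
have -> : step (fun s => \sum_(tr : n.-tuple _ | s2 \notin s :: unzip2 tr)
             traj_prob pi s tr) s1 =
          step (fun s => \sum_(tr : n.-tuple _)
             traj_prob pi s tr * (s2 \notin s :: unzip2 tr)%:R) s1.
  apply: eq_step => s; rewrite big_mkcond; apply: eq_bigr => tr _.
  by case: ifP => _; rewrite ?mulr1 ?mulr0.
rewrite -(@traj_step n (fun x tr => (s2 \notin x.2 :: unzip2 tr)%:R) _ s1) //.
rewrite mulr_sumr; apply: eq_bigr => -[a s'] _; rewrite mulr_sumr.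
apply: eq_bigr => tr _ /=; rewrite [s2 \in s1 :: _]in_cons negb_or (eq_sym s2).
by case: (s1 != s2); case: (s2 \notin _) => /=;
  rewrite ?mul0r ?mul1r ?mulr0 ?mulr1.
Qed.

(** Drift argument: away from [s2] the potential [w] falls by at least 1 per step in mean. Since [w]
    is nonnegative, it dominates every partial sum of the probabilities of not having hit [s2]. *)
Lemma expected_hitting_time_le s1 s2 w :
  (forall s, 0 <= w s) -> (forall s, s != s2 -> 1 + step w s <= w s) ->
  (expected_hitting_time pi s1 s2 <= (w s1)%:E)%E.
Proof.
move=> w0 wS.
have bnd n s : \sum_(k < n) unhit_prob pi s s2 k <= w s.
  elim: n s => [|n IH] s; first by rewrite big_ord0.
  rewrite big_ord_recl unhit_prob0.
  under eq_bigr do rewrite unhit_probS.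
  rewrite -mulr_sumr -(step_sum (fun k : 'I_n => (unhit_prob pi)^~ s2 ^~ k)).
  case: eqP => [_|/eqP sN] /=; first by rewrite mul0r addr0.
  by rewrite mul1r; apply: le_trans (wS s sN); rewrite lerD2l; apply: step_le.
have prob_ge0 s tr : 0 <= traj_prob pi s tr.
  elim: tr s => [|[a s'] tr IH] s //=; rewrite !mulr_ge0 ?fdist_ge0 //.
apply: lime_le.
  apply: is_cvg_nneseries => n _ _; rewrite lee_fin; apply: sumr_ge0 => *.
  exact: prob_ge0.
apply: nearW => n; rewrite sumEFin lee_fin big_mkord; exact: bnd.
Qed.

End Values.

(** * Gains and their measurability *)

Section LimitLevelSets.
Context {d : measure_display} {T : measurableType d} {R : realType}.

Lemma measurable_lt_cst (g : T -> R) (k : R) :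
  measurable_fun setT g -> measurable [set x | g x < k].
Proof.
move=> mg; have -> : [set x | g x < k] = setT `&` g @^-1` `]-oo, k[.
  by apply/seteqP; split => x /=; rewrite in_itv //= => -[].
exact: mg.
Qed.

(** By completeness, convergence is the Cauchy property, which involves only countably many
    tolerances [k.+1%:R^-1] and indices. *)
Lemma measurable_cvgn (u : nat -> T -> R) :
  (forall n, measurable_fun setT (u n)) ->
  measurable [set x | cvgn (u ^~ x)].
Proof.
move=> mu.
rewrite (_ : [set x | _] = \bigcap_k \bigcup_N \bigcap_(n in [set n | (N <= n)%N])
    [set x | `|u n x - u N x| < k.+1%:R^-1]).
  apply: bigcapT_measurable => k; apply: bigcup_measurable => N _.
  apply: bigcap_measurable; first by exists N => /=.
  move=> n _; apply: measurable_lt_cst; apply: measurableT_comp => //.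
  exact: measurable_funB.
apply/seteqP; split => x /= => [cu k _|cu].
- have e0 : 0 < k.+1%:R^-1 / 2 :> R by rewrite divr_gt0.
  have /cvgrPdist_lt/(_ _ e0) [N _ hN] := cu.
  exists N => // n /= Nn.
  have /= h1 := hN n Nn; have /= h2 := hN N (leqnn N).
  rewrite (_ : _ - _ = (lim (u ^~ x @ \oo) - u N x) - (lim (u ^~ x @ \oo) - u n x));
    last by ring.
  by apply: le_lt_trans (ler_normB _ _) _; rewrite [ltRHS]splitr ltrD.
- apply: cauchy_cvg; apply: cauchy_exP => e e0.
  have [k ke] : exists k : nat, k.+1%:R^-1 < e.
    exists (Num.truncn e^-1); rewrite invf_plt ?posrE //.
    by have := truncnS_gt e^-1.
  have [N _ hN] := cu k I; exists (u N x); exists N => // n /= Nn.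
  rewrite /ball /= distrC; exact: lt_trans (hN n Nn) ke.
Qed.

(** Off the convergence set [limn] takes the default value 0, so there the level set is everything
    or nothing, according to the sign of [c]. *)
Lemma measurable_le_limn (u : nat -> T -> R) (c : R) :
  (forall n, measurable_fun setT (u n)) ->
  measurable [set x | c <= limn (u ^~ x)].
Proof.
move=> mu; set D := [set x | cvgn (u ^~ x)].
have mD : measurable D := measurable_cvgn mu.
have mlim : measurable_fun D (fun x => limn (u ^~ x)).
  by apply: (@measurable_fun_cvg _ _ _ D u) => // m; apply: measurable_funTS.
rewrite (_ : [set x | _] = (D `&` (fun x => limn (u ^~ x)) @^-1` `[c, +oo[)
   `|` (~` D `&` [set _ | c <= 0])).
  apply: measurableU; first exact: mlim.
  apply: measurableI; first exact: measurableC.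
  case: (boolP (c <= 0)) => _; last by rewrite (_ : [set _ | _] = set0) // -subset0.
  by rewrite (_ : [set _ | _] = setT) //; apply/seteqP.
apply/seteqP; split => x /=.
  move=> cx; have [Dx|Dx] := pselect (D x); first by left; rewrite in_itv /= andbT.
  by right; split => //; rewrite (dvgP Dx) in cx.
case=> [[_]|[Dx c0]]; first by rewrite in_itv /= andbT.
by rewrite (dvgP Dx).
Qed.

End LimitLevelSets.

Section Gain.
Context {R : realType} {M : mdp R}.
Implicit Types (pi : policy M) (s : state M).

Lemma reward_bounds s a : 0 <= reward s a <= 1.
Proof. by move: M s a => [[S A r hS hA hr] P] /=. Qed.

Lemma gainE pi s :
  gain pi s = limn (fun n => n%:R^-1 * value pi (@reward R M) n s).
Proof.
by congr (limn _); apply/funext => n; rewrite expected_returnE.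
Qed.

Lemma gain_le1 pi s : gain pi s <= 1.
Proof.
rewrite gainE; set u := fun n => _.
have [cu|/dvgP ->] := pselect (cvgn u); last exact: ler01.
apply: limr_le => //; apply: nearW => n; rewrite /u.
case: n => [|n]; first by rewrite mulr0 ler01.
rewrite mulrC ler_pdivrMr ?ltr0n // mul1r.
rewrite -[leRHS]mulr1 -(value_cst pi 1 n.+1 s); apply: value_le => t a.
by have /andP[] := reward_bounds t a.
Qed.

Lemma gain_le_optimal pi s : gain pi s <= optimal_gain s.
Proof.
apply: ub_le_sup; last by exists pi.
by exists 1 => _ [pi' _ <-]; exact: gain_le1.
Qed.

Lemma gain_eq pi s (g B : R) :
  (forall n, `|value pi (@reward R M) n s - n%:R * g| <= B) -> gain pi s = g.
Proof.
move=> hB; rewrite gainE; apply: cvg_lim => //.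
(* Shifting the index avoids division by zero at horizon 0; the averages are then squeezed between g
   - B/(n+1) and g + B/(n+1). *)
rewrite -(cvg_shiftS (fun n => n%:R^-1 * value pi (@reward R M) n s)) /=.
have cB : g - B * harmonic n @[n --> \oo] --> g.
  rewrite -[X in _ --> X](subr0 g); apply: cvgB; first exact: cvg_cst.
  rewrite -[X in _ --> X](mulr0 B); apply: cvgM; first exact: cvg_cst.
  exact: cvg_harmonic.
have cB' : g + B * harmonic n @[n --> \oo] --> g.
  rewrite -[X in _ --> X](addr0 g); apply: cvgD; first exact: cvg_cst.
  rewrite -[X in _ --> X](mulr0 B); apply: cvgM; first exact: cvg_cst.
  exact: cvg_harmonic.
apply: squeeze_cvgr cB cB'; apply: nearW => n; rewrite /harmonic /=.
have n0 : 0 < n.+1%:R :> R by rewrite ltr0n.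
have n0' : n.+1%:R != 0 :> R by rewrite gt_eqF.
have -> : g - B * n.+1%:R^-1 = (n.+1%:R * g - B) / n.+1%:R by field.
have -> : g + B * n.+1%:R^-1 = (n.+1%:R * g + B) / n.+1%:R by field.
rewrite [X in _ <= X <= _]mulrC.
rewrite ler_pM2r ?invr_gt0 // ler_pM2r ?invr_gt0 //.
have := hB n.+1; rewrite ler_norml; set a := _ * g; set v := value _ _ _ _.
move=> /andP[h1 h2]; rewrite -[_ + step _ _ _]/v.
apply/andP; split; lra.
Qed.

(* A non-convergent average has gain 0, the junk value of [lim]. *)
Lemma gain_lower pi s (g e : R) : 0 < g -> 0 < e -> g <= gain pi s ->
  \forall n \near \oo, n%:R * (g - e) <= value pi (@reward R M) n s.
Proof.
move=> g0 e0; rewrite gainE; set u := fun n => _.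
have [cu gu|/dvgP ->] := pselect (cvgn u); last by rewrite leNgt g0.
have /cvgrPdist_lt/(_ _ e0) [N _ hN] := cu.
exists N.+1 => //= n Nn; have /= := hN n (ltnW Nn).
have n0 : 0 < n%:R :> R by rewrite ltr0n (leq_trans _ Nn).
move=> /ltr_distlBl /ltW /(le_trans (lerB gu (lexx e))).
by rewrite /u mulrC ler_pdivlMr // mulrC.
Qed.

End Gain.

Section PolicyMeasurability.
Context {R : realType} {M : mdp R}.

Lemma measurable_policy_coord (s : state M) (a : action M) :
  measurable_fun setT (fun pi : policy_space M => (pi : policy M) s a).
Proof.
move=> _ U mU; rewrite setTI; apply: sub_sigma_algebra.
by exists s, a, U.
Qed.

Lemma measurable_value (c : state M -> action M -> R) n s :
  measurable_fun setT (fun pi : policy_space M => value (pi : policy M) c n s).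
Proof.
elim: n s => [|n IH] s /=; first exact: measurable_cst.
apply: measurable_funD; apply: measurable_sum => a; apply: measurable_funM;
  do ?exact: measurable_policy_coord; first exact: measurable_cst.
apply: measurable_sum => s'; apply: measurable_funM => //.
Qed.

(** Values are polynomial in the coordinates of the policy, and there are finitely many states.
    Measurability is what allows passing to the complementary event and integrating indicators. *)
Lemma measurable_eps_optimal (eps : R) :
  measurable ([set pi | eps_optimal eps pi] : set (policy_space M)).
Proof.
rewrite (_ : [set pi | _] = \bigcap_(s in [set: state M])
    [set pi | optimal_gain s - eps <= gain pi s]).
  apply: fin_bigcap_measurable; first exact: finite_finset.
  move=> s _; under eq_set do rewrite gainE.
  apply: (@measurable_le_limn _ (policy_space M) R
    (fun n pi => n%:R^-1 * value (pi : policy M) (@reward R M) n s)) => n.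
  apply: measurable_funM; [exact: measurable_cst | exact: measurable_value].
by apply/seteqP; split => pi /= h s; [move=> _; exact: h | exact: h].
Qed.

End PolicyMeasurability.

(** * Change of measure for sampling strategies *)

Lemma big_option (R : nmodType) (T : finType) (F : option T -> R) :
  \sum_o F o = F None + \sum_x F (Some x).
Proof.
rewrite (bigD1 None) //=; congr (_ + _).
rewrite (reindex_omap Some id) /=; first by apply: eq_bigl => x; rewrite eqxx.
by case.
Qed.

Section Sampling.
Context {R : realType} {E : environment R}.
Variable alg : algorithm R.
Implicit Types (P : state E -> action E -> fdist R (state E)).
Implicit Types (h : history E) (x : state E * action E).

Definition stop h : R := next_query (alg E) h None.
Definition query h x : R := next_query (alg E) h (Some x).
Definition hprob P h : R := history_prob alg (M := MDP P) h.

Lemma stop_ge0 h : 0 <= stop h. Proof. exact: fdist_ge0. Qed.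

Lemma hprob_ge0 P h : 0 <= hprob P h.
Proof.
by elim: h => [|[[s a] s'] h IH]; rewrite /hprob //= !mulr_ge0 ?fdist_ge0.
Qed.

Lemma sum_query h : \sum_x query h x = 1 - stop h.
Proof.
rewrite -(fdist_sum1 (next_query (alg E) h)) big_option /stop.
by rewrite addrC addrK.
Qed.

(** Conditioning on the newest sample, which is the head of the history. *)
Lemma hprob_step P n (F : history E -> R) :
  \sum_(h : n.+1.-tuple (state E * action E * state E)) hprob P h * F h
  = \sum_(h : n.-tuple (state E * action E * state E)) hprob P h *
      \sum_x query h x * mean (P x.1 x.2) (fun s' => F ((x, s') :: h)).
Proof.
rewrite sum_tuple_cons exchange_big /=; apply: eq_bigr => h _.
rewrite mulr_sumr.
transitivity (\sum_x \sum_s' hprob P ((x, s') :: h) * F ((x, s') :: h)).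
  by rewrite pair_big; apply: eq_bigr => -[].
apply: eq_bigr => -[s a] _ /=; rewrite /mean !mulr_sumr.
by apply: eq_bigr => s' _; rewrite /query /hprob /=; ring.
Qed.

(** Mean of [O] at the stopping history, restricted to runs with fewer than [n] samples. The
    truncation keeps all sums finite even if the algorithm may run forever. *)
Definition stop_sum P (O : history E -> R) n : R :=
  \sum_(k < n) \sum_(h : k.-tuple (state E * action E * state E))
    hprob P h * (stop h * O h).

Definition query_sum P (c : state E * action E -> R) n : R :=
  \sum_(k < n) \sum_(h : k.-tuple (state E * action E * state E))
    hprob P h * \sum_x query h x * c x.

(** Wald's identity at the stopping time truncated at [n]: each query of [x] raises [F] by [c x] in
    conditional mean. *)
Lemma stop_sum_telescope P (F : history E -> R) (c : state E * action E -> R) n :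
  F [::] = 0 ->
  (forall h x, mean (P x.1 x.2) (fun s' => F ((x, s') :: h)) = F h + c x) ->
  stop_sum P F n
    + \sum_(h : n.-tuple (state E * action E * state E)) hprob P h * F h
  = query_sum P c n.
Proof.
move=> F0 FS; elim: n => [|n IH].
  by rewrite /stop_sum /query_sum !big_ord0 sum_tuple0 F0 mulr0 addr0.
rewrite /query_sum big_ord_recr -[X in _ = X + _]IH /stop_sum big_ord_recr /=.
rewrite hprob_step -!addrA; congr (_ + _); rewrite -!big_split.
apply: eq_bigr => h _ /=; rewrite -!mulrDr; congr (_ * _).
have -> : \sum_x query h x * mean (P x.1 x.2) (fun s' => F ((x, s') :: h))
  = \sum_x query h x * F h + \sum_x query h x * c x.
  by rewrite -big_split; apply: eq_bigr => x _; rewrite FS mulrDr.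
by rewrite -mulr_suml sum_query; ring.
Qed.

Lemma total_mass P n :
  stop_sum P (fun=> 1) n
    + \sum_(h : n.-tuple (state E * action E * state E)) hprob P h = 1.
Proof.
elim: n => [|n IH].
  by rewrite /stop_sum big_ord0 sum_tuple0 add0r.
rewrite -[RHS]IH /stop_sum big_ord_recr /= -addrA; congr (_ + _).
have -> : \sum_(h : n.+1.-tuple (state E * action E * state E)) hprob P h
  = \sum_(h : n.+1.-tuple (state E * action E * state E)) hprob P h * 1.
  by apply: eq_bigr => h _; rewrite mulr1.
rewrite (hprob_step P n (fun=> 1))  -big_split; apply: eq_bigr => h _ /=.
under eq_bigr do rewrite mean_cst mulr1.
by rewrite sum_query; ring.
Qed.

Lemma stop_sumD P O O' n :
  stop_sum P (fun h => O h + O' h) n = stop_sum P O n + stop_sum P O' n.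
Proof.
rewrite -big_split; apply: eq_bigr => k _; rewrite -big_split.
by apply: eq_bigr => h _ /=; rewrite !mulrDr.
Qed.

Lemma stop_sumZ P (c : R) O n :
  stop_sum P (fun h => c * O h) n = c * stop_sum P O n.
Proof.
rewrite /stop_sum mulr_sumr; apply: eq_bigr => k _; rewrite mulr_sumr.
by apply: eq_bigr => h _ /=; ring.
Qed.

Lemma stop_sum_sum P (I : finType) (O : I -> history E -> R) n :
  stop_sum P (fun h => \sum_i O i h) n = \sum_i stop_sum P (O i) n.
Proof.
rewrite exchange_big; apply: eq_bigr => k _; rewrite exchange_big.
by apply: eq_bigr => h _ /=; rewrite !mulr_sumr.
Qed.

Lemma stop_sum_le P O O' n :
  (forall h, O h <= O' h) -> stop_sum P O n <= stop_sum P O' n.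
Proof.
move=> OO'; apply: ler_sum => k _; apply: ler_sum => h _.
by rewrite !ler_wpM2l ?hprob_ge0 ?stop_ge0.
Qed.

Lemma stop_sum_mono P O n m : (forall h, 0 <= O h) -> (n <= m)%N ->
  stop_sum P O n <= stop_sum P O m.
Proof.
move=> O0 nm; rewrite /stop_sum -!(big_mkord xpredT
  (fun k => \sum_(h : k.-tuple (state E * action E * state E))
    hprob P h * (stop h * O h))).
rewrite (big_cat_nat _ nm) //= lerDl; apply: sumr_ge0 => k _.
by apply: sumr_ge0 => h _; rewrite !mulr_ge0 ?hprob_ge0 ?stop_ge0.
Qed.

Lemma stop_sum_le1 P O n : (forall h, O h <= 1) -> stop_sum P O n <= 1.
Proof.
move=> O1; rewrite -(total_mass P n); apply: le_trans (stop_sum_le P n O1) _.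
by rewrite lerDl; apply: sumr_ge0 => h _; exact: hprob_ge0.
Qed.

Lemma query_sum_le P c c' n :
  (forall x, c x <= c' x) -> query_sum P c n <= query_sum P c' n.
Proof.
move=> cc'; apply: ler_sum => k _; apply: ler_sum => h _.
rewrite ler_wpM2l ?hprob_ge0 //; apply: ler_sum => x _.
by rewrite ler_wpM2l ?fdist_ge0.
Qed.

Lemma query_sumZ P (a : R) c n :
  query_sum P (fun x => a * c x) n = a * query_sum P c n.
Proof.
rewrite /query_sum mulr_sumr; apply: eq_bigr => k _; rewrite mulr_sumr.
apply: eq_bigr => h _ /=; rewrite !mulr_sumr; apply: eq_bigr => x _; ring.
Qed.

Lemma query_sum_sum P (I : finType) (c : I -> state E * action E -> R) n :
  query_sum P (fun x => \sum_i c i x) n = \sum_i query_sum P (c i) n.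
Proof.
rewrite exchange_big; apply: eq_bigr => k _; rewrite exchange_big.
apply: eq_bigr => h _ /=; rewrite -mulr_sumr exchange_big; congr (_ * _).
by apply: eq_bigr => x _; rewrite mulr_sumr.
Qed.

Section ChangeOfMeasure.
Variables (P0 P1 : state E -> action E -> fdist R (state E)).
Variable l : state E * action E * state E -> R.
Hypothesis P01 : forall s a s', P0 s a s' = P1 s a s' * expR (l (s, a, s')).

Definition llr h : R := \sum_(e <- h) l e.

Definition klq x : R := mean (P0 x.1 x.2) (fun s' => l (x, s')).

Lemma hprob_llr h : hprob P0 h = hprob P1 h * expR (llr h).
Proof.
rewrite /llr; elim: h => [|[[s a] s'] h IH]; first by rewrite big_nil expR0 mulr1.
rewrite big_cons expRD /hprob /= -![history_prob _ _]/(hprob _ h) IH P01.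
by ring.
Qed.

(* [exp(-u) >= 1 - u] at [u = llr h - lam]. *)
Lemma hprob_llr_ge h (lam : R) :
  hprob P0 h * (1 + lam) - hprob P1 h * expR lam <= hprob P0 h * llr h.
Proof.
have h1 : hprob P1 h = hprob P0 h * expR (- llr h).
  by rewrite hprob_llr -mulrA -expRD subrr expR0 mulr1.
rewrite h1 -mulrA -expRD -mulrBr; apply: ler_wpM2l; first exact: hprob_ge0.
have := expR_ge1Dx (- llr h + lam); lra.
Qed.

(** By [stop_sum_telescope], the right side is the mean log-likelihood ratio at the truncated
    stopping time. It is bounded below by [hprob_llr_ge], at [lam] on the part weighted by [O] and
    at 0 on the part weighted by [1 - O] and on the runs still going; both total masses are 1 and
    cancel. *)
Lemma change_of_measure (O : history E -> R) (lam : R) n :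
  (forall h, 0 <= O h <= 1) ->
  lam * stop_sum P0 O n - expR lam * stop_sum P1 O n <= query_sum P0 klq n.
Proof.
move=> O01.
rewrite -(@stop_sum_telescope P0 llr klq n) ?/llr ?big_nil //; last first.
  move=> h x; rewrite (eq_mean _ (g := fun s' => \sum_(e <- h) l e + l (x, s'))).
    by rewrite meanD mean_cst.
  by move=> s'; rewrite big_cons addrC.
rewrite -[fun h => _]/llr.
have surv : \sum_(h : n.-tuple (state E * action E * state E)) hprob P0 h
   - \sum_(h : n.-tuple (state E * action E * state E)) hprob P1 h
   <= \sum_(h : n.-tuple (state E * action E * state E)) hprob P0 h * llr h.
  rewrite -sumrB; apply: ler_sum => h _.
  by have := hprob_llr_ge h 0; rewrite expR0 addr0 !mulr1.
have stopped : stop_sum P0 (fun=> 1) n - stop_sum P1 (fun=> 1) n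
    + lam * stop_sum P0 O n - (expR lam - 1) * stop_sum P1 O n
   <= stop_sum P0 llr n.
  rewrite -!stop_sumZ /stop_sum -!sumrB -!big_split -!sumrB /=.
  apply: ler_sum => k _; rewrite -!sumrB -!big_split -!sumrB /=.
  apply: ler_sum => h _.
  have /andP[Oge0 Ole1] := O01 h.
  have := ler_wpM2l (mulr_ge0 (stop_ge0 h) Oge0) (hprob_llr_ge h lam).
  have O0' : 0 <= 1 - O h by rewrite subr_ge0.
  have := ler_wpM2l (mulr_ge0 (stop_ge0 h) O0') (hprob_llr_ge h 0).
  rewrite expR0; lra.
have O1 : stop_sum P1 O n <= 1 by apply: stop_sum_le1 => h; have /andP[] := O01 h.
have O0 : 0 <= stop_sum P1 O n.
  apply: sumr_ge0 => k _; apply: sumr_ge0 => h _; have /andP[Oge0 _] := O01 h.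
  by rewrite !mulr_ge0 ?hprob_ge0 ?stop_ge0.
have := total_mass P0 n; have := total_mass P1 n; lra.
Qed.

End ChangeOfMeasure.

Definition output_mass (B : set (policy E)) h : R := fine (output (alg E) h B).

Lemma output_mass_bounds B h : measurable (B : set (policy_space E)) ->
  0 <= output_mass B h <= 1.
Proof.
move=> mB; rewrite -!lee_fin fineK ?measure_ge0 ?probability_le1 //.
exact: fin_num_measure.
Qed.

(** Gives a finite horizon: if all partial sums stayed below [y], so would the series. *)
Lemma output_prob_stop_sum P (B : set (policy E)) (x y : R) :
  measurable (B : set (policy_space E)) ->
  (x%:E <= output_prob alg (M := MDP P) B)%E -> y < x ->
  exists n, y < stop_sum P (output_mass B) n.
Proof.
move=> mB xB yx; apply: contrapT => /forallNP hn.
suff : (output_prob alg (M := MDP P) B <= y%:E)%E.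
  by move=> /(le_trans xB); rewrite lee_fin leNgt yx.
have termE (k : nat) : (\sum_(h : k.-tuple (state E * action E * state E))
    (history_prob alg (M := MDP P) h * next_query (alg E) h None)%:E
      * output (alg E) h B
  = (\sum_(h : k.-tuple (state E * action E * state E))
      hprob P h * (stop h * output_mass B h))%:E)%E.
  rewrite -sumEFin; apply: eq_bigr => h _.
  rewrite -[output _ _ _]fineK ?fin_num_measure // -EFinM; congr (_%:E).
  by rewrite -mulrA.
rewrite /output_prob; apply: lime_le.
  apply: is_cvg_nneseries => n _ _; rewrite termE lee_fin.
  apply: sumr_ge0 => h _; rewrite !mulr_ge0 ?hprob_ge0 ?stop_ge0 //.
  by have /andP[] := output_mass_bounds h mB.
apply: nearW => n; rewrite big_mkord.
under eq_bigr do rewrite termE.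
by rewrite sumEFin lee_fin leNgt; apply/negP/hn.
Qed.

(** At a large enough horizon the success mass exceeds 1 - delta - e while success and failure
    together have mass at most 1; the failure mass at [n] is no larger than at that horizon. *)
Lemma stop_sum_complement_le P (B : set (policy E)) (delta : R) n :
  measurable (B : set (policy_space E)) ->
  ((1 - delta)%:E <= output_prob alg (M := MDP P) B)%E ->
  stop_sum P (fun h => 1 - output_mass B h) n <= delta.
Proof.
move=> mB hB; have O01 := fun h => output_mass_bounds h mB.
apply/ler_addgt0Pr => e e0.
have y1 : 1 - delta - e < 1 - delta by lra.
have [m hm] := output_prob_stop_sum mB hB y1.
have h0 h : 0 <= 1 - output_mass B h by have := O01 h; lra.
have h1 h : 0 <= output_mass B h by have := O01 h; lra.
have := stop_sum_mono P h0 (leq_maxl n m).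
have := stop_sum_mono P h1 (leq_maxr n m).
have := stop_sumD P (output_mass B) (fun h => 1 - output_mass B h) (maxn n m).
have := @stop_sum_le1 P (fun h => output_mass B h + (1 - output_mass B h))
  (maxn n m).
have le1 h : output_mass B h + (1 - output_mass B h) <= 1 by lra.
move=> /(_ le1); lra.
Qed.

Lemma query_sum_le_expected P n :
  ((query_sum P (fun=> 1%R) n)%:E <= expected_samples alg (MDP P))%E.
Proof.
rewrite /expected_samples.
have -> : query_sum P (fun=> 1) n = \sum_s \sum_a \sum_(k < n)
   \sum_(h : k.-tuple (state E * action E * state E)) hprob P h * query h (s, a).
  rewrite pair_big exchange_big; apply: eq_bigr => k _.
  rewrite exchange_big; apply: eq_bigr => h _ /=.
  by rewrite mulr_sumr; apply: eq_bigr => -[s a] _; rewrite mulr1.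
rewrite -sumEFin; apply: lee_sum => s _; rewrite -sumEFin; apply: lee_sum => a _.
rewrite /expected_queries -sumEFin -(big_mkord xpredT (fun k : nat =>
  (\sum_(h : k.-tuple (state E * action E * state E))
     hprob P h * query h (s, a))%:E)).
apply: (@nneseries_lim_ge R _ xpredT) => k _ _; rewrite lee_fin.
apply: sumr_ge0 => h _; rewrite mulr_ge0 ?hprob_ge0 //; exact: fdist_ge0.
Qed.

End Sampling.

(** Integrates the pointwise bound on how many of the sets contain [x]. *)
Lemma sum_probability_le d (T : measurableType d) (R : realType)
    (mu : probability T R) (I : finType) (A : I -> set T) (K : R) :
  (forall i, measurable (A i)) -> (forall x, \sum_i \1_(A i) x <= K) ->
  \sum_i fine (mu (A i)) <= K.
Proof.
move=> mA AK; rewrite -lee_fin -sumEFin.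
under eq_bigr => i _ do rewrite fineK ?fin_num_measure //
  -[A i]setIT -(integral_indic _ (@measurableT _ T) (mA i)).
have mf i : measurable_fun setT (fun x => (\1_(A i) x)%:E : \bar R).
  by apply/measurable_EFinP; exact: measurable_indic.
have f0 i x : setT x -> (0 <= (\1_(A i) x)%:E :> \bar R)%E by rewrite lee_fin.
rewrite -(@ge0_integral_sum _ _ _ mu setT measurableT _ _ mf f0).
apply: le_trans (_ : (\int[mu]_(x in setT) (cst K%:E x) <= _)%E).
  apply: ge0_le_integral => //.
  - by move=> x _; apply: sume_ge0 => i _; exact: f0.
  - exact: emeasurable_sum.
  - by move=> x _; rewrite /= sumEFin lee_fin.
by rewrite integral_cst // [X in (_ * X <= _)%E](probability_setT mu) mule1.
Qed.

(** * The hard instances *)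

Section HardInstances.
Context {R : realType}.
Variables n m : nat.

Local Notation node := 'I_n.+1.
Local Notation arm := 'I_m.+2.
Local Notation index := (node * arm)%type.

(* [None] is a resting state without reward and [Some x] the node [x] of the
   heap-ordered (m+2)-ary tree on [0, n], whose root [Some 0] is entered from
   [None]. The action [(true, b)] is the arm [b], which keeps collecting reward 1
   at its node until it falls back to [None]; [(false, b)] moves to the [b]-th
   child (to the root if there is none), with reward 1/2. *)
Definition hub_reward (s : option node) (a : bool * arm) : R :=
  if s is Some _ then if a.1 then 1 else 2^-1 else 0.

Fact hub_state_gt0 : (0 < #|{: option node}|)%N.
Proof. by rewrite card_option. Qed.

Fact hub_action_gt0 : (0 < #|{: bool * arm}|)%N.
Proof. by rewrite card_prod card_bool card_ord. Qed.

Fact hub_reward_bounds s a : 0 <= hub_reward s a <= 1.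
Proof. by rewrite /hub_reward; case: s => [x|]; case: a.1; lra. Qed.

Definition hub_env : environment R :=
  Environment hub_state_gt0 hub_action_gt0 hub_reward_bounds.

(** With b = [m.+2], the children of x are xb, ..., xb + b - 1, so the parent map is division by b
    and the root is its own parent. Out of range, [inord] returns 0, the root. *)
Definition successor (s : state hub_env) (a : action hub_env) : state hub_env :=
  if s is Some x then if a.1 then None else Some (inord (x * m.+2 + a.2))
  else Some ord0.

Fact lazy_subproof (w : R) (s t : state hub_env) : 0 <= w <= 1 ->
  let f := [ffun u => (1 - w) * (u == s)%:R + w * (u == t)%:R] in
  [forall u, 0 <= f u] && (\sum_u f u == 1).
Proof.
move=> /andP[w0 w1] /=; apply/andP; split.
  apply/forallP => u; rewrite ffunE.
  by rewrite addr_ge0 // mulr_ge0 ?ler0n ?subr_ge0.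
under eq_bigr do rewrite ffunE.
rewrite big_split /= -!mulr_sumr.
have sum1 v : \sum_(u : state hub_env) (u == v)%:R = 1 :> R.
  by rewrite (bigD1 v) //= eqxx big1 ?addr0 // => u /negbTE ->.
by rewrite !sum1; apply/eqP; ring.
Qed.

Variables p kappa : R.
Hypothesis p_bounds : 0 < p <= 2^-1.
Hypothesis kappa_bounds : 2^-1 <= kappa <= 1.

Implicit Types (o : option index) (i : index).
Implicit Types (s : state hub_env) (a : action hub_env).

Definition is_arm i s a := (s, a) == (Some i.1, (true, i.2)).

(* The target arm [o] of the instance, if any, is left with the smaller
   probability [kappa * p]. *)
Definition leave o s a : R :=
  if s is Some x then
    if a.1 then if o == Some (x, a.2) then kappa * p else p else 1
  else p.

Fact leave_bounds o s a : 0 <= leave o s a <= 1.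
Proof.
move: p_bounds kappa_bounds => pb kb.
have kp : 0 <= kappa * p <= 1 by apply/andP; split; nra.
by rewrite /leave; case: s => [x|]; last lra; case: a.1; [case: ifP|]; lra.
Qed.

Lemma leave_neq_arm i s a : ~~ is_arm i s a -> leave (Some i) s a = leave None s a.
Proof.
rewrite /leave; case: s => // x; case: a => -[] b //= ia.
by case: eqP => // -[ixb]; rewrite ixb /is_arm eqxx in ia.
Qed.

Definition hub_trans o s a : fdist R (state hub_env) :=
  FDist (lazy_subproof s (successor s a) (leave_bounds o s a)).

Definition hub_mdp o : mdp R := MDP (hub_trans o).

Lemma mean_hub_trans o s a f :
  mean (hub_trans o s a) f
  = (1 - leave o s a) * f s + leave o s a * f (successor s a).
Proof.
rewrite /mean /=; under eq_bigr do rewrite ffunE mulrDl -!mulrA.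
rewrite big_split /= -!mulr_sumr.
have pick v : \sum_(u : state hub_env) (u == v)%:R * f u = f v.
  rewrite (bigD1 v) //= eqxx mul1r big1 ?addr0 // => u /negbTE ->.
  by rewrite mul0r.
by rewrite !pick.
Qed.

Lemma sum_is_arm_le s a : \sum_i (is_arm i s a)%:R <= 1 :> R.
Proof.
under eq_bigr do rewrite mulrb.
rewrite -big_mkcond /=.
case: s => [x|]; last by rewrite big_pred0.
case: a => -[] b; last first.
  by rewrite big_pred0 // => -[y c]; rewrite /is_arm xpair_eqE andbF.
rewrite (big_pred1 (x, b)) // => -[y c]; rewrite /is_arm /=.
by apply/eqP/eqP => -[-> ->].
Qed.

(** * Expected numbers of arm pulls *)

Section Pulls.
Variable pi : policy hub_env.

Definition pulls o i k s : R :=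
  value (M := hub_mdp o) pi (fun s a => (is_arm i s a)%:R) k s.

Lemma pulls_ge0 o i k s : 0 <= pulls o i k s.
Proof. by apply: value_ge0 => *; rewrite ler0n. Qed.

Lemma pullsS o i k s :
  pulls o i k.+1 s = mean (pi s) (fun a => (is_arm i s a)%:R
    + ((1 - leave o s a) * pulls o i k s
       + leave o s a * pulls o i k (successor s a))).
Proof.
rewrite /pulls /= /avg_cost /step -meanD; apply: eq_mean => a.
by rewrite mean_hub_trans.
Qed.

Lemma sum_pulls_le o k s : \sum_i pulls o i k s <= k%:R.
Proof.
rewrite -value_sum -[leRHS]mulr1 -(value_cst (M := hub_mdp o) pi 1 k s).
by apply: value_le => t a; exact: sum_is_arm_le.
Qed.

(** Each pull of [i] falls back to rest with probability [p], so at most 1/p pulls are expected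
    before the first such fall; afterwards the chain is at rest with less time left. *)
Lemma pulls_rest i k s : pulls None i k s <= p^-1 + pulls None i k None.
Proof.
have /andP[p0 p1] := p_bounds.
have pV : p * p^-1 = 1 by rewrite mulfV ?gt_eqF.
have : 0 < p^-1 by rewrite invr_gt0.
move: (p^-1) pV => q pq q0.
elim: k s => [|k IH] s; first by rewrite addr0 ltW.
rewrite pullsS; apply: mean_le_cst => a.
have mono : pulls None i k None <= pulls None i k.+1 None.
  by apply: value_mono => *; rewrite ler0n.
have [/eqP[-> ->]|_] := boolP (is_arm i s a).
  rewrite /=; have p1' : 0 <= 1 - p by lra.
  by have := ler_wpM2l p1' (IH (Some i.1)); lra.
have /andP[l0 l1] := leave_bounds None s a.
have l1' : 0 <= 1 - leave None s a by rewrite subr_ge0.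
rewrite add0r; have := ler_wpM2l l0 (IH (successor s a)).
have := ler_wpM2l l1' (IH s); lra.
Qed.

(* A pull of the target arm of [hub_mdp (Some i)] is, with probability
   [1 - kappa], a null step, and otherwise a pull in [hub_mdp None]. *)
Lemma pulls_slowdown i k s :
  kappa * pulls (Some i) i k s <= pulls None i k s.
Proof.
have /andP[p0 p1] := p_bounds; have /andP[k0 k1] := kappa_bounds.
elim: k s => [|k IH] s; first by rewrite mulr0.
rewrite pullsS -meanZ [leRHS]pullsS; apply: mean_le => a.
have [/eqP[-> ->]|/negbTE ia] := boolP (is_arm i s a).
  rewrite /= -surjective_pairing eqxx.
  have := IH (Some i.1); have := IH None; have := pulls_rest i k (Some i.1).
  set u := pulls (Some i) i k _; set v := pulls None i k _.
  set u' := pulls (Some i) i k _; set v' := pulls None i k _.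
  (* The induction hypotheses leave a gap of (1 - kappa) times the inequality [pulls_rest] scaled by
     [p]. *)
  move=> /(ler_wpM2l (ltW p0)); rewrite mulrDr mulfV ?gt_eqF // => h1 h2 h3.
  have k1' : 0 <= 1 - kappa by rewrite subr_ge0.
  have := ler_wpM2l k1' h1.
  have kp0 : 0 <= kappa * p by nra.
  have kp1 : 0 <= 1 - kappa * p by nra.
  have := ler_wpM2l kp0 h2; have := ler_wpM2l kp1 h3; lra.
rewrite (leave_neq_arm (negbT ia)).
have /andP[l0 l1] := leave_bounds None s a.
rewrite !add0r.
have := ler_wpM2l l0 (IH (successor s a)).
have l1' : 0 <= 1 - leave None s a by rewrite subr_ge0.
have := ler_wpM2l l1' (IH s); lra.
Qed.

End Pulls.

Implicit Types (pi : policy hub_env).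

(** The potential worth 1/(2p) at nodes and 0 at rest solves the Poisson equation under every
    policy, once 1/2 per step and (1 - kappa)/2 per pull of [i] are subtracted from the reward. Its
    bound, used twice, gives the term [p^-1]. *)
Lemma value_reward_le pi i k s :
  value (M := hub_mdp (Some i)) pi (@reward R hub_env) k s
  <= k%:R * 2^-1 + (1 - kappa) / 2 * pulls pi (Some i) i k s + p^-1.
Proof.
have /andP[p0 p1] := p_bounds; have p0' : p != 0 by rewrite gt_eqF.
have ip0 : 0 < p^-1 by rewrite invr_gt0.
pose h (t : state hub_env) : R := if t is Some _ then p^-1 / 2 else 0.
pose c (t : state hub_env) (a : action hub_env) : R :=
  reward t a + (- 2^-1 + - ((1 - kappa) / 2) * (is_arm i t a)%:R).
have hB t : `|h t| <= p^-1 / 2.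
  by rewrite /h; case: t => [_|]; rewrite ger0_norm; lra.
have hP t : avg_cost (M := hub_mdp (Some i)) pi c t
    + step (M := hub_mdp (Some i)) pi h t = h t.
  rewrite /avg_cost /step -meanD -[RHS](mean_cst (pi t)); apply: eq_mean => a.
  rewrite mean_hub_trans /c /h; case: t a => [x|] [[] b] /=; last 2 first.
  - by field.
  - by field.
  - have -> : is_arm i (Some x) (true, b) = (Some i == Some (x, b)).
      by rewrite /is_arm; case: (i) => y d; apply/eqP/eqP => -[-> ->].
    by case: eqP => _ /=; rewrite ?mulr1 ?mulr0; field.
  - by rewrite /is_arm xpair_eqE andbF mulr0 addr0; field.
have := value_poisson (M := hub_mdp (Some i)) k s hB hP.
rewrite /c valueD valueD valueZ value_cst -/(pulls pi (Some i) i k s) ler_norml.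
move=> /andP[_]; have := hB s; rewrite ler_norml => /andP[_]; lra.
Qed.

(** * Descent in the tree, diameter and optimal gain *)

Definition dist (t x : node) : nat :=
  find (fun l => t %/ m.+2 ^ l == x)%N (iota 0 n.+2).

Definition ancestor (t x : node) : bool :=
  has (fun l => t %/ m.+2 ^ l == x)%N (iota 0 n.+2).

(** After n + 1 divisions every node has become the root, so the search range 0, ..., n + 1 of
    [dist] and [ancestor] loses nothing. *)
Lemma divn_expn_eq0 (t : node) l : (n < l)%N -> (t %/ m.+2 ^ l = 0)%N.
Proof.
move=> nl; apply: divn_small; apply: leq_trans (ltn_ord t) _.
by apply: leq_trans nl _; apply: ltnW; apply: ltn_expl.
Qed.

Lemma dist_le (t x : node) l : (t %/ m.+2 ^ l = x)%N ->
  ancestor t x /\ (dist t x <= l)%N.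
Proof.
have small j : (j < n.+2)%N -> (t %/ m.+2 ^ j = x)%N ->
    ancestor t x /\ (dist t x <= j)%N.
  move=> jn tx; split; first by apply/hasP; exists j; rewrite ?mem_iota ?tx.
  rewrite leqNgt; apply/negP => /(before_find 0%N).
  by rewrite nth_iota // add0n tx eqxx.
move=> tx; have [ln|nl] := ltnP l n.+2; first exact: small.
have [] := small n.+1 _ _ => //.
  by rewrite -tx !divn_expn_eq0 // ltnW.
by move=> -> le; split => //; apply: leq_trans le (ltnW nl).
Qed.

Lemma divn_dist (t x : node) : ancestor t x -> (t %/ m.+2 ^ dist t x = x)%N.
Proof.
move=> tx; have := nth_find 0%N tx; rewrite nth_iota ?add0n; first by move/eqP.
by move: tx; rewrite /ancestor has_find size_iota.
Qed.

(** Were the distance above L, [x] would be the root, which is already reached at level L. *)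
Lemma dist_bound (t x : node) L : (n < m.+2 ^ L)%N -> ancestor t x ->
  (dist t x <= L)%N.
Proof.
move=> nL tx; rewrite leqNgt; apply/negP => Ld.
have tL : (t %/ m.+2 ^ L = 0)%N.
  by apply: divn_small; apply: leq_trans (ltn_ord t) _.
suff : (t %/ m.+2 ^ L = x)%N by move=> /dist_le[_]; rewrite leqNgt Ld.
rewrite tL -(divn_dist tx) -(subnKC (ltnW Ld)) expnD divnMA tL.
by rewrite div0n.
Qed.

Lemma ancestor_root (t : node) : ancestor t ord0.
Proof. by have [] := @dist_le t ord0 n.+1 (divn_expn_eq0 t (ltnSn n)). Qed.

(** The base-b digit of [t] that selects the child of [x] on the path to [t]. *)
Definition route_arm (t x : node) : arm :=
  inord (t %/ m.+2 ^ (dist t x).-1 %% m.+2).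

Lemma successor_route (t x : node) : x != t -> ancestor t x ->
  exists y : node, [/\ successor (Some x) (false, route_arm t x) = Some y,
    ancestor t y & dist t x = (dist t y).+1].
Proof.
move=> xt tx; have dE := divn_dist tx.
have d0 : (0 < dist t x)%N.
  rewrite lt0n; apply: contra xt => /eqP d0; rewrite d0 expn0 divn1 in dE.
  by apply/eqP/val_inj; rewrite /= dE.
set q := (t %/ m.+2 ^ (dist t x).-1)%N.
have qx : (q %/ m.+2 = x)%N by rewrite -divnMA -expnSr prednK.
(* The next node [q] on the path is at most [t], so [inord] does not wrap to the root. *)
have qn : (q < n.+1)%N by apply: leq_ltn_trans (leq_div _ _) (ltn_ord t).
have [tq dq] := @dist_le t (Ordinal qn) _ erefl.
exists (Ordinal qn); split => //.
  rewrite /= /route_arm inordK ?ltn_pmod // -{1}qx -divn_eq.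
  by congr Some; apply: val_inj; rewrite /= inordK.
have [_ le] := @dist_le t x (dist t (Ordinal qn)).+1 (etrans
  (etrans (f_equal (fun k => t %/ k)%N (expnSr _ _)) (divnMA _ _ _))
  (etrans (f_equal (fun k => k %/ m.+2)%N (divn_dist tq)) qx)).
by apply/eqP; rewrite eqn_leq le -(prednK d0) ltnS.
Qed.

(** A node off the path to [i.1] is left by pulling an arm, which leads back to rest; at rest the
    action has no effect. *)
Definition act_to i s : action hub_env :=
  if s is Some x then
    if (x != i.1) && ancestor i.1 x then (false, route_arm i.1 x)
    else (true, i.2)
  else (true, i.2).

Definition policy_to i : policy hub_env := [ffun s => fdist_dirac R (act_to i s)].

Lemma step_policy_to o i f s :
  step (M := hub_mdp o) (policy_to i) f s
  = (1 - leave o s (act_to i s)) * f s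
    + leave o s (act_to i s) * f (successor s (act_to i s)).
Proof. by rewrite /step ffunE mean_dirac mean_hub_trans. Qed.

Lemma leave_arm_ge o x b : p / 2 <= leave o (Some x) (true, b).
Proof.
have /andP[p0 _] := p_bounds; have /andP[k0 _] := kappa_bounds.
by rewrite /=; case: ifP => _; nra.
Qed.

(** L bounds the depth. Every arm is left within 2/p steps in mean, the resting state within 1/p,
    and the descent takes at most L; the potentials [w] add up these durations. *)
Lemma diameter_hub o L : (n < m.+2 ^ L)%N ->
  (diameter (hub_mdp o) <= (L%:R + 3 / p)%:E)%E.
Proof.
have /andP[p0 p1] := p_bounds; have p0' : p != 0 by rewrite gt_eqF.
have ip0 : 0 < p^-1 by rewrite invr_gt0.
have pV : p * p^-1 = 1 by rewrite mulfV.
move=> nL; apply: bigmax_le => [|[s1 s2] /= _].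
  by rewrite lee_fin; have : 0 <= L%:R :> R by []; lra.
apply: le_trans (_ : (expected_hitting_time (M := hub_mdp o)
  (policy_to (odflt ord0 s2, ord0)) s1 s2 <= _)%E).
  by apply: ereal_inf_lbound; exists (policy_to (odflt ord0 s2, ord0)).
case: s2 => [t|].
- pose w (s : state (hub_mdp o)) : R :=
    if s is Some x then if ancestor t x then (dist t x)%:R
      else L%:R + 3 / p else L%:R + p^-1.
  have L0 : 0 <= L%:R :> R by [].
  apply: le_trans (_ : ((w s1)%:E <= _)%E).
    apply: expected_hitting_time_le => [s|s st].
      rewrite /w; case: s => [x|]; last lra.
      by case: ifP => // _; lra.
    rewrite step_policy_to /=; case: s st => [x|] st; last first.
      rewrite /w /= ancestor_root.
      have : (dist t ord0)%:R <= L%:R :> R.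
        by rewrite ler_nat dist_bound ?ancestor_root.
      by move=> /(ler_wpM2l (ltW p0)); lra.
    have xt : x != t by apply: contraNneq st => ->.
    rewrite /act_to /= xt /=; case: (boolP (ancestor t x)) => tx.
      have [y [[/= ->] -> ->]] := successor_route xt tx.
      rewrite -natr1; lra.
    have := leave_arm_ge o x ord0; rewrite /=.
    set l := if _ then _ else _.
    have p3 : 0 <= 2 / p by lra.
    by move=> /(ler_wpM2r p3); lra.
  rewrite lee_fin /w; case: s1 => [x|]; last lra.
  case: ifP => tx; last lra.
  have : (dist t x)%:R <= L%:R :> R by rewrite ler_nat dist_bound.
  lra.
- pose w (s : state (hub_mdp o)) : R := if s is Some x then 2 / p else 0.
  have L0 : 0 <= L%:R :> R by [].
  apply: le_trans (_ : ((w s1)%:E <= _)%E); last first.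
    by rewrite lee_fin /w; case: s1 => [x|]; lra.
  apply: expected_hitting_time_le => [s|[x|] // _].
    by rewrite /w; case: s => [x|]; lra.
  rewrite step_policy_to /act_to /=.
  (* The root has no ancestor but itself, so the policy aimed at it pulls arm 0 at every node. *)
  have -> : (x != ord0) && ancestor ord0 x = false.
    apply/negP => /andP[/eqP x0 /divn_dist]; rewrite div0n => x0'.
    by apply: x0; apply: val_inj.
  have := leave_arm_ge o x ord0; rewrite /w /=.
  set l := if _ then _ else _.
  have p2 : 0 <= 2 / p by lra.
  by move=> /(ler_wpM2r p2); lra.
Qed.

(** A cycle has 1/p resting steps of reward 0, d descending steps of reward 1/2 and 1/(kappa p)
    pulls of reward 1 on average; the gain is the ratio of reward to length. The proof exhibits a
    solution of the Poisson equation. *)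
Lemma gain_policy_to i s :
  gain (M := hub_mdp (Some i)) (policy_to i) s
  = 2^-1 + (1 - kappa) / (2 * (1 + kappa + kappa * ((dist i.1 ord0)%:R * p))).
Proof.
have /andP[p0 p1] := p_bounds; have p0' : p != 0 by rewrite gt_eqF.
have /andP[k0 k1] := kappa_bounds.
set d : R := (dist i.1 ord0)%:R.
have dp : 0 <= d * p by rewrite mulr_ge0 // ltW.
have D0 : 0 < 1 + kappa + kappa * (d * p) by nra.
set x := (1 - kappa) / _; set g := 2^-1 + x.
have xE : 2 * x * (1 + kappa + kappa * (d * p)) = 1 - kappa.
  by rewrite /x; field; rewrite -?mulrA gt_eqF.
(* The potential is 0 at the target node: a descending step loses x = g - 1/2, a stay at rest loses
   g/p, and a stay at a node off the path wins (1 - g)/p. The equation at the target is then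
   [xE]. *)
pose hub := - x * d - g / p.
pose h (t : state (hub_mdp (Some i))) : R :=
  if t is Some y then
    if ancestor i.1 y then - x * (dist i.1 y)%:R else hub + (1 - g) / p
  else hub.
pose B := \sum_t `|h t|.
have hB t : `|h t| <= B.
  by rewrite /B (bigD1 t) //= lerDl; apply: sumr_ge0.
have hP t : avg_cost (M := hub_mdp (Some i)) (policy_to i)
      (fun t a => reward t a + - g) t
    + step (M := hub_mdp (Some i)) (policy_to i) h t = h t.
  rewrite step_policy_to /avg_cost ffunE mean_dirac.
  case: t => [y|]; last first.
    by rewrite /= ancestor_root -/d /hub; field.
  rewrite /act_to; case: (eqVneq y i.1) => [->|yi] /=.
    have [ai di] : ancestor i.1 i.1 /\ (dist i.1 i.1 <= 0)%N.
      by apply: dist_le; rewrite expn0 divn1.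
    move: di; rewrite leqn0 => /eqP di.
    rewrite ai di mulr0 -surjective_pairing eqxx mulr0 add0r /hub /g.
    have -> : kappa * p * (- x * d - (2^-1 + x) / p)
      = - kappa * (x * (d * p) + (2^-1 + x)) by field.
    lra.
  case: (boolP (ancestor i.1 y)) => ay /=.
    have [z [[/= ->] -> ->]] := successor_route yi ay.
    by rewrite -natr1 /g; field.
  have -> : (Some i == Some (y, i.2)) = false.
    by apply: contraNF yi => /eqP[->].
  by field.
apply: (gain_eq (B := B + B)) => k.
have := value_poisson (M := hub_mdp (Some i)) k s hB hP.
have -> : value (M := hub_mdp (Some i)) (policy_to i) (fun t a => reward t a + - g)
    k s = value (M := hub_mdp (Some i)) (policy_to i) (@reward R hub_env) k s
          - k%:R * g.
  by rewrite valueD value_cst mulrN.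
have := hB s; rewrite !ler_norml => /andP[h1 h2] /andP[h3 h4].
by apply/andP; split; lra.
Qed.

Lemma optimal_gain_ge i s : (dist i.1 ord0)%:R * p <= 3 ->
  2^-1 + (1 - kappa) / 10 <= optimal_gain (M := hub_mdp (Some i)) s.
Proof.
move=> dp3.
apply: le_trans (gain_le_optimal (M := hub_mdp (Some i)) (policy_to i) s).
have /andP[p0 p1] := p_bounds; have /andP[k0 k1] := kappa_bounds.
have dp : 0 <= (dist i.1 ord0)%:R * p by rewrite mulr_ge0 // ltW.
rewrite gain_policy_to lerD2l; move: (_ * p) dp dp3 => z z0 z3.
apply: ler_wpM2l; first by rewrite subr_ge0.
(* The denominator is at most 2(1 + 1 + 3) = 10. *)
rewrite lef_pV2 ?posrE //; nra.
Qed.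

(** * Divergence between the reference and the perturbed instances *)

Definition arm_llr i (e : state hub_env * action hub_env * state hub_env) : R :=
  if is_arm i e.1.1 e.1.2 then
    if e.2 == None then - ln kappa else ln ((1 - p) / (1 - kappa * p))
  else 0.

Lemma arm_llrP i s a s' :
  hub_trans None s a s' = hub_trans (Some i) s a s' * expR (arm_llr i (s, a, s')).
Proof.
have /andP[p0 p1] := p_bounds; have /andP[k0 k1] := kappa_bounds.
have kp : 0 < 1 - kappa * p by nra.
rewrite /arm_llr /=; case: ifPn => [/eqP[-> ->]|ia]; last first.
  by rewrite expR0 mulr1 !ffunE (leave_neq_arm ia).
rewrite !ffunE /= -surjective_pairing eqxx.
case: s' => [x|] /=.
  rewrite !mulr0 !addr0 lnK ?posrE ?divr_gt0 //; last lra.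
  by rewrite mulrAC mulrCA mulrA mulfK ?gt_eqF // mulrC.
rewrite expRN lnK ?posrE; last lra.
rewrite !mulr0 !add0r !mulr1 mulrC mulKf // gt_eqF //; lra.
Qed.

(** The inequality ln y <= y - 1 bounds the divergence by the chi-square one, (1 - kappa)^2 p /
    (kappa (1 - kappa p)), whose denominator is at least 1/4. *)
Lemma klq_arm_llr i (x : state hub_env * action hub_env) :
  klq (hub_trans None) (arm_llr i) x
  <= (is_arm i x.1 x.2)%:R * (4 * (1 - kappa) ^+ 2 * p).
Proof.
have /andP[p0 p1] := p_bounds; have /andP[k0 k1] := kappa_bounds.
have kp : 0 < 1 - kappa * p by nra.
rewrite /klq mean_hub_trans /arm_llr; case: x => s a /=.
case: ifPn => [/eqP[-> ->]|_]; last by rewrite !mulr0 addr0 mul0r.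
rewrite /= mul1r.
have lnV : - ln kappa <= kappa^-1 - 1.
  rewrite -lnV ?posrE; last lra.
  have := @le_ln1Dx R (kappa^-1 - 1).
  rewrite (_ : 1 + (kappa^-1 - 1) = kappa^-1); last by ring.
  apply; have : 0 < kappa^-1 by rewrite invr_gt0; lra.
  lra.
have ln1 : ln ((1 - p) / (1 - kappa * p)) <= (1 - p) / (1 - kappa * p) - 1.
  have := @le_ln1Dx R ((1 - p) / (1 - kappa * p) - 1).
  rewrite (_ : 1 + (_ - 1) = (1 - p) / (1 - kappa * p)); last by ring.
  apply; have : 0 < (1 - p) / (1 - kappa * p) by rewrite divr_gt0 //; lra.
  lra.
have p1' : 0 <= 1 - p by lra.
apply: le_trans (lerD (ler_wpM2l p1' ln1) (ler_wpM2l (ltW p0) lnV)) _.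
have -> : (1 - p) * ((1 - p) / (1 - kappa * p) - 1) + p * (kappa^-1 - 1)
  = (1 - kappa) ^+ 2 * p * ((kappa * (1 - kappa * p))^-1).
  by field; rewrite !gt_eqF //; lra.
have -> : 4 * (1 - kappa) ^+ 2 * p = (1 - kappa) ^+ 2 * p * 4 by ring.
apply: ler_wpM2l; first by rewrite mulr_ge0 ?sqr_ge0 // ltW.
rewrite -[leRHS]invrK lef_pV2 ?posrE ?mulr_gt0 //; [nra|lra].
Qed.

(** * Overlap of the sets of near-optimal policies and sample count *)

Section Overlap.
Variable eps : R.
Hypothesis eps_gt0 : 0 < eps.
Hypothesis kappaE : kappa = 1 - 20 * eps.
Hypothesis dist_root : forall t : node, (dist t ord0)%:R * p <= 3.

Lemma eps_optimal_pulls pi i : eps_optimal (M := hub_mdp (Some i)) eps pi ->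
  \forall k \near \oo, k%:R / 80 <= pulls pi None i k None.
Proof.
move=> opt; have /andP[p0 p1] := p_bounds; have /andP[k0 k1] := kappa_bounds.
have eps0 := eps_gt0; have g0 : 0 < 2^-1 + eps by lra.
have e0 : 0 < eps / 2 by lra.
(* The optimal gain is at least 1/2 + 20 eps / 10, and [pi] loses at most eps. *)
have glow : 2^-1 + eps <= gain (M := hub_mdp (Some i)) pi None.
  have := opt None; have := optimal_gain_ge None (dist_root i.1).
  by rewrite {1}kappaE; lra.
have big : \forall k \near \oo, 4 / eps / p <= k%:R by exact: nbhs_infty_ger.
have low := gain_lower g0 e0 glow.
near=> k.
have hk : 4 / eps / p <= k%:R by near: k.
have lk : k%:R * (2^-1 + eps - eps / 2) <=
    value (M := hub_mdp (Some i)) pi (@reward R hub_env) k None by near: k.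
have := value_reward_le pi i k None; have := pulls_slowdown pi i k None.
have := pulls_ge0 pi (Some i) i k None.
move: (pulls _ _ _ _ _) (pulls _ _ _ _ _) => v u u0 uv vle.
(* Of the excess k eps / 2, half absorbs [p^-1] for large k, leaving [u] at least k/40; the slowdown
   factor kappa >= 1/2 makes this k/80. *)
have ve : k%:R * (eps / 2) <= 10 * eps * u + p^-1.
  by have := le_trans lk vle; rewrite {1}kappaE; lra.
have pk : p^-1 <= k%:R * (eps / 4).
  have e4 : 0 <= eps / 4 by lra.
  have := ler_wpM2r e4 hk.
  by rewrite (_ : 4 / eps / p * (eps / 4) = p^-1) //; field; rewrite !gt_eqF.
have uk : k%:R / 40 <= u.
  have e40 : 0 < 10 * eps by lra.
  rewrite -(ler_pM2l e40); lra.
have ku : 2^-1 * u <= kappa * u by rewrite ler_wpM2r.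
lra.
Unshelve. all: by end_near.
Qed.

(** As there are finitely many arms, one horizon k serves them all; each counted arm takes k/80 of
    the at most k expected pulls. *)
Lemma eps_optimal_overlap pi :
  \sum_i (`[< eps_optimal (M := hub_mdp (Some i)) eps pi >])%:R <= 80 :> R.
Proof.
have all_i : \forall k \near \oo, forall i : index,
    `[< eps_optimal (M := hub_mdp (Some i)) eps pi >] ->
    k%:R / 80 <= pulls pi None i k None.
  apply: filter_forall => i; case: asboolP => [opt|_].
    by apply: filterS (eps_optimal_pulls opt) => k.
  by apply: nearW.
have pos : \forall k \near \oo, (0 < k)%N by exists 1%N.
near \oo => k.
have k0 : 0 < k%:R :> R by rewrite ltr0n; near: k.
have hk : forall i : index, `[< eps_optimal (M := hub_mdp (Some i)) eps pi >] ->
    k%:R / 80 <= pulls pi None i k None by near: k.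
have k80 : 0 < k%:R / 80 :> R by lra.
rewrite -(ler_pM2r k80) mulr_suml [leRHS](_ : _ = k%:R); last by field.
apply: le_trans (sum_pulls_le pi None k None); apply: ler_sum => i _.
by have := hk i; case: asboolP => _ /= h; rewrite ?mul1r ?mul0r ?pulls_ge0 ?h.
Unshelve. all: by end_near.
Qed.

Lemma communicating_hub o : communicating (hub_mdp o).
Proof.
apply: le_lt_trans (ltry _); apply: (@diameter_hub o n.+1).
by apply: ltnW; apply: ltn_expl.
Qed.

Lemma samples_lower_bound (alg : algorithm R) (delta : R) :
  0 < delta <= expR (- 8) -> (240 <= #|{: index}|)%N -> correct eps delta alg ->
  exists k, ln delta^-1 * #|{: index}|%:R / 4
    <= 4 * (20 * eps) ^+ 2 * p * query_sum alg (hub_trans None) (fun=> 1) k.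
Proof.
move=> /andP[d0 d8]; rewrite -(ler_nat R); set N : R := #|_|%:R => N240 cor.
pose lam := ln delta^-1.
have expR_lam : expR lam = delta^-1 by rewrite lnK // posrE invr_gt0.
have lam8 : 8 <= lam.
  rewrite -ler_expR expR_lam -[leLHS]invrK.
  by rewrite lef_pV2 ?posrE ?invr_gt0 ?expR_gt0 // -expRN.
have d9 : delta <= 9^-1.
  apply: le_trans d8 _; rewrite expRN lef_pV2 ?posrE ?expR_gt0 //.
  by have := expR_ge1Dx (8 : R); lra.
pose good o : set (policy hub_env) :=
  [set pi | eps_optimal (M := hub_mdp o) eps pi].
have mgood o : measurable (good o : set (policy_space hub_env)).
  exact: (@measurable_eps_optimal R (hub_mdp o) eps).
have goodP o := cor (hub_mdp o) (communicating_hub o).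
(* Correctness on the reference instance serves to find a horizon k before which the algorithm stops
   with probability at least 3/4. *)
have y1 : 3 / 4 < 1 - delta by lra.
have [k hk] := output_prob_stop_sum (mgood None) (goodP None) y1.
exists k; have [K K0 KE] : exists2 K, 0 <= K & K = 4 * (20 * eps) ^+ 2 * p.
  have /andP[p0 _] := p_bounds; exists (4 * (20 * eps) ^+ 2 * p); last by [].
  by apply: mulr_ge0 (ltW p0); apply: mulr_ge0 (sqr_ge0 _); exact: ler0n.
rewrite -KE; pose T := stop_sum alg (hub_trans None) (fun=> 1) k.
have T34 : 3 / 4 <= T.
  apply: le_trans (ltW hk) _; apply: stop_sum_le => h.
  by have /andP[] := output_mass_bounds alg h (mgood None).
pose bad i (h : history hub_env) : R := 1 - output_mass alg (good (Some i)) h.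
have bad01 i h : 0 <= bad i h <= 1.
  by have := output_mass_bounds alg h (mgood (Some i)); rewrite /bad; lra.
have one i : lam * stop_sum alg (hub_trans None) (bad i) k - 1
    <= query_sum alg (hub_trans None)
         (fun x => K * (is_arm i x.1 x.2)%:R) k.
  apply: le_trans (_ : query_sum alg (hub_trans None)
    (klq (hub_trans None) (arm_llr i)) k <= _); last first.
    apply: query_sum_le => x; apply: le_trans (klq_arm_llr i x) _.
    by rewrite KE [in X in X <= _]kappaE; lra.
  (* Under the instance of [i] the bad event has mass at most delta = exp(-lam), so the subtracted
     term is at most 1. *)
  have := change_of_measure alg (arm_llrP i) lam k (bad01 i).
  apply: le_trans; rewrite lerB // expR_lam mulrC ler_pdivrMr // mul1r.
  exact: stop_sum_complement_le (mgood (Some i)) (goodP (Some i)).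
have sum_one : lam * ((N - 80) * T) - N <= K
    * query_sum alg (hub_trans None) (fun=> 1) k.
  rewrite -query_sumZ.
  apply: le_trans (_ : \sum_i query_sum alg (hub_trans None)
         (fun x => K * (is_arm i x.1 x.2)%:R) k <= _).
    apply: le_trans (ler_sum _ (fun i _ => one i)).
    rewrite sumrB -mulr_sumr -stop_sum_sum sumr_const -/N lerD2r.
    rewrite ler_wpM2l //; first lra.
    (* For every output law, the probabilities of being good for the various arms sum to at most 80,
       so those of being bad sum to at least N - 80. *)
    rewrite /T -stop_sumZ; apply: stop_sum_le => h.
    rewrite mulr1 sumrB sumr_const -/N lerD2l lerN2.
    apply: sum_probability_le => [i|pi]; first exact: mgood.
    apply: le_trans (eps_optimal_overlap pi); apply: ler_sum => i _.
    by rewrite indicE; exact: lexx.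
  rewrite -query_sum_sum; apply: query_sum_le => x; rewrite -mulr_sumr.
  by apply: ler_wpM2l => //; exact: sum_is_arm_le.
apply: le_trans sum_one; rewrite -/lam.
(* Equivalent to N >= 240 when T = 3/4; then lam >= 8 absorbs the term N. *)
have NT : N / 2 <= (N - 80) * T.
  have N80 : 0 <= N - 80 by lra.
  by have := ler_wpM2l N80 T34; lra.
have lam0 : 0 <= lam by lra.
have := ler_wpM2l lam0 NT.
have N0 : 0 <= N by lra.
have := ler_wpM2r N0 lam8; lra.
Qed.

End Overlap.

End HardInstances.

(** * Choice of the parameters *)

Theorem theorem4 (R : realType) :
  exists (c c1 c2 eps0 delta0 : R) (S0 A0 : nat),
    [/\ 0 < c, 0 < c1, 0 < c2, 0 < eps0 & 0 < delta0] /\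
    forall (eps delta : R) (nS nA : nat) (D : R) (alg : algorithm R),
      0 < eps <= eps0 -> 0 < delta <= delta0 ->
      (S0 <= nS)%N -> (A0 <= nA)%N ->
      Num.max (c1 * (ln nS%:R / ln nA%:R)) c2 <= D ->
      correct eps delta alg ->
      exists M : mdp R,
        [/\ communicating M,
            (#|state M| <= nS)%N, (#|action M| <= nA)%N,
            (diameter M <= D%:E)%E &
            ((c * nS%:R * nA%:R * D * eps ^- 2 * ln (delta^-1))%:E
               <= expected_samples alg M)%E].
Proof.
(* With p = 6/D, D >= 12 gives p <= 1/2, and eps <= 1/40 gives kappa >= 1/2. The divergence per
   query is 4 (20 eps)^2 p = 9600 eps^2 / D and there are at least SA/8 arms, so c = 1/(9600 *
   32). *)
exists (48 * 80 * 80)^-1, 8, 12, 40^-1, (expR (- 8)), 31%N, 32%N.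
split; first by split; rewrite ?expR_gt0 //; lra.
move=> eps delta nS nA D alg /andP[e0 e1] d01 S31 A32.
rewrite ge_max => /andP[DlnS D12] cor.
pose n := (nS - 2)%N; pose m := (nA./2 - 2)%N.
have nE : nS = n.+2 by rewrite /n; lia.
have mE : nA./2 = m.+2 by rewrite /m; lia.
have mA : (m.+2 * 2 <= nA < m.+2 * 2 + 2)%N by lia.
have nA0 : (0 < nA)%N by exact: leq_trans A32.
have n0 : (0 < n)%N by rewrite -2!ltnS -nE; exact: leq_trans S31.
have nnS : (n <= nS)%N by rewrite nE -addn2 leq_addr.
have nAsq : (nA <= m.+2 ^ 2)%N by rewrite -mulnn; nia.
have N240 : (240 <= n.+1 * m.+2)%N by nia.
have cards : (nS * nA <= n.+1 * m.+2 * 8)%N by nia.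
pose p : R := 6 / D; pose kappa : R := 1 - 20 * eps.
have D0 : 0 < D by lra.
have p0 : 0 < p by rewrite divr_gt0.
have pb : 0 < p <= 2^-1 by rewrite p0 /= ler_pdivrMr //; lra.
have kb : 2^-1 <= kappa <= 1 by rewrite /kappa; lra.
have Dp : 3 / p = D / 2 by rewrite /p; field; rewrite gt_eqF.
pose L := (trunc_log m.+2 n).+1.
have nL : (n < m.+2 ^ L)%N by exact: trunc_log_ltn.
(* As A <= b^2, the logarithm in base b is at most 2 ln S / ln A <= D/4, and the extra 1 in [L] is
   at most D/12. The other half of the diameter is 3/p = D/2. *)
have LD : L%:R <= D / 2.
  have nat_gt0 k : (0 < k)%N -> 0 < k%:R :> R by rewrite ltr0n.
  have lnA0 : 0 < ln nA%:R :> R by rewrite ln_gt0 // ltr1n; exact: leq_trans A32.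
  have AM : ln nA%:R <= 2 * ln m.+2%:R :> R.
    rewrite mulr_natl -lnXn ?nat_gt0 // ler_ln ?posrE ?exprn_gt0 ?nat_gt0 //.
    by rewrite -natrX ler_nat.
  have TS : (trunc_log m.+2 n)%:R * ln m.+2%:R <= ln nS%:R :> R.
    rewrite mulr_natl -lnXn ?nat_gt0 // ler_ln ?posrE ?exprn_gt0 ?nat_gt0 //;
      last exact: leq_trans S31.
    by rewrite -natrX ler_nat; apply: leq_trans nnS; exact: trunc_logP.
  have TA : (trunc_log m.+2 n)%:R <= 2 * (ln nS%:R / ln nA%:R) :> R.
    rewrite mulrA ler_pdivlMr //.
    apply: le_trans (ler_wpM2l _ AM) _ => //; lra.
  by rewrite /L -natr1; lra.
have rootD (t : 'I_n.+1) : (dist m t ord0)%:R * p <= 3.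
  have : (dist m t ord0)%:R <= D / 2.
    by apply: le_trans LD; rewrite ler_nat dist_bound // ancestor_root.
  have <- : D / 2 * p = 3 by rewrite /p; field; rewrite gt_eqF.
  exact: ler_wpM2r (ltW p0) _ _.
have index240 : (240 <= #|{: 'I_n.+1 * 'I_m.+2}|)%N.
  by rewrite card_prod !card_ord.
have [k hk] := samples_lower_bound pb kb e0 erefl rootD d01 index240 cor.
(* The witness is the reference instance, whatever the algorithm; the perturbed ones entered only
   through correctness. *)
exists (hub_mdp pb kb (None : option ('I_n.+1 * 'I_m.+2))); split.
- exact: communicating_hub.
- by rewrite card_option card_ord nE.
- rewrite card_prod card_bool card_ord mulnC.
  by case/andP: mA.
- apply: le_trans (diameter_hub pb kb None nL) _.
  by rewrite lee_fin Dp; lra.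
apply: le_trans (query_sum_le_expected alg (hub_trans pb kb None) k).
rewrite lee_fin.
have lam0 : 0 <= ln delta^-1.
  have /andP[d0 d1] := d01.
  rewrite ln_ge0 // invf_ge1 //; apply: le_trans d1 _.
  by rewrite -[leRHS]expR0 ler_expR; lra.
have c0 : 0 < 4 * (20 * eps) ^+ 2 * p.
  apply: (mulr_gt0 _ p0); apply: mulr_gt0; first exact: ltr0n.
  by apply: exprn_gt0; apply: (mulr_gt0 _ e0); exact: ltr0n.
rewrite -(ler_pM2l c0); apply: le_trans hk.
have -> : 4 * (20 * eps) ^+ 2 * p
    * ((48 * 80 * 80)^-1 * nS%:R * nA%:R * D * eps ^- 2 * ln delta^-1)
  = ln delta^-1 * (nS%:R * nA%:R / 8) / 4.
  by rewrite /p; field; rewrite !gt_eqF.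
rewrite ler_pM2r // ler_wpM2l // card_prod !card_ord ler_pdivrMr //.
by rewrite -!natrM ler_nat.
Qed.
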